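(* Let $a,b\ge 1$, let $X\sim\mathrm{Beta}(a,b)$, and let $p:=a/(a+b)$. Then for every $\varepsilon\ge 0$, \[ P(X-p\ge\varepsilon)\ \le\ \exp\Bigl(-\frac{(a+b+1+a/b)\,\varepsilon^2}{2\bigl[p(1-p)+(2/3)(1-2p)^+\varepsilon\bigr]}\Bigr). \]
   Context: $\mathrm{Beta}(a,b)$ is the beta distribution with density proportional to $x^{a-1}(1-x)^{b-1}$ on $(0,1)$; $s^+:=\max\{s,0\}$. *)

(* Defs.v *)
From HB Require Import structures.
From mathcomp Require Import all_boot all_order all_algebra.
From mathcomp Require Import all_classical all_reals all_analysis.

Set Implicit Arguments.
Unset Strict Implicit.
Unset Printing Implicit Defensive.
Import Order.TTheory GRing.Theory Num.Theory.
Import numFieldNormedType.Exports.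

Local Open Scope classical_set_scope.
Local Open Scope ring_scope.

(* The beta_prob of MathComp-Analysis only covers parameters in nat; here the
   parameters are arbitrary reals. *)

Definition beta_weight (R : realType) (a b x : R) : R :=
  x `^ (a - 1) * (1 - x) `^ (b - 1).

Definition beta_norm (R : realType) (a b : R) : R :=
  \int[lebesgue_measure]_(x in `]0, 1[) beta_weight a b x.

Definition beta_density (R : realType) (a b : R) : R -> R :=
  (fun x => beta_weight a b x / beta_norm a b) \_ `]0, 1[.

Definition has_beta_law (R : realType) (d : measure_display)
    (T : measurableType d) (P : probability T R) (X : {RV P >-> R})
    (a b : R) : Prop :=
  forall A : set R, measurable A ->
    distribution P X A =
    (\int[lebesgue_measure]_(x in A) (beta_density a b x)%:E)%E.

(* Main.v *)
Require Import Defs.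
From HB Require Import structures.
From mathcomp Require Import all_boot all_order all_algebra.
From mathcomp Require Import all_classical all_reals all_analysis.
From mathcomp Require Import measurable_realfun ring lra.

(** Write [n = a + b], [p = a / n], [q = 1 - p], let [f] be the density, [Phi]
the distribution function, and [K(x) = p ln (p/x) + q ln (q/(1-x))] the relative
entropy between Bernoulli laws. The proof rests on three facts.

- Entropy decay ([tail_over_stein_weight_nincr]). Let [G(x) = x (1-x) f(x)], which
  is proportional to [x^a (1-x)^b], hence to [exp(-n K(x))], and satisfies
  [G' = n (p - x) f]. Then [(1 - Phi)/G] is nonincreasing on all of [(0,1)], so
  that [P(X >= x) <= P(X >= p) exp(-n K(x))] for [x >= p].

- The mean is not an extreme quantile ([beta_cdf_mean_ge]): [Phi(p) >= 1/e], the
  one-dimensional inequality of Gruenbaum. Since [Phi] has density [f] on [(0,1)],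
  [ln Phi(X)] has expectation [-1]; and [ln Phi] lies below its tangent at [p],
  an affine function whose expectation is [ln Phi(p)].
  Consequently [P(X >= p) <= 1 - 1/e <= 2/e = exp(-(1 - ln 2))].

- The announced exponent exceeds [n K] by at most [1 - ln 2]
  ([bernstein_le_entropy_scaled]). Put [x = p + q t] with [0 <= t < 1]. The
  exponent is [(b+1) T(t)] and [n K(x) = b k(t)] with functions [T <= k] that
  depend on [p] only, so [b = 1] is the worst case and the claim becomes
  [2 T - k <= 1 - ln 2]. Let [beta] be the positive part of
  [1 - 2 p], [c(t) = p + beta t] and [M = c(1)]. The relative square
  [u(t) = M t^2 / c(t)] increases from 0 to 1, and
  [T' <= t/c], [k' >= (t/c)/(1-u)], [t/c <= u']. Hence [2 T - k] can
  increase only while [u <= 1/2], and there it grows no faster than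
  [2u + ln(1-u)], whose value at [u = 1/2] is [1 - ln 2].

So the excess of the exponent over [n K] is paid for by the constant factor that
is gained at the mean. Multiplying the first two bounds and inserting the third
gives the theorem. *)

Set Implicit Arguments.
Unset Strict Implicit.
Unset Printing Implicit Defensive.
Import Order.TTheory GRing.Theory Num.Theory.
Import numFieldNormedType.Exports.

Local Open Scope classical_set_scope.
Local Open Scope ring_scope.

(** * Derivatives and monotonicity *)

Section pointwise_derivatives.
Context {R : realType}.
Implicit Types (f g : R -> R) (x df dg : R).

(** The rules are stated for pointwise expressions [fun t => f t + g t], with
[t] bound, so that [derive_step] can read the rule to apply off the body of the
function. *)
Lemma is_derive_fctD f g x df dg : is_derive x 1 f df -> is_derive x 1 g dg ->
  is_derive x 1 (fun t => f t + g t) (df + dg).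
Proof. by move=> ? ?; exact: is_deriveD. Qed.

Lemma is_derive_fctB f g x df dg : is_derive x 1 f df -> is_derive x 1 g dg ->
  is_derive x 1 (fun t => f t - g t) (df - dg).
Proof. by move=> ? ?; exact: is_deriveB. Qed.

Lemma is_derive_fctN f x df : is_derive x 1 f df ->
  is_derive x 1 (fun t => - f t) (- df).
Proof. by move=> ?; exact: is_deriveN. Qed.

Lemma is_derive_fctM f g x df dg : is_derive x 1 f df -> is_derive x 1 g dg ->
  is_derive x 1 (fun t => f t * g t) (f x * dg + g x * df).
Proof. by move=> ? ?; exact: is_deriveM. Qed.

Lemma is_derive_fct_sqr f x df : is_derive x 1 f df ->
  is_derive x 1 (fun t => f t ^+ 2) (2 * f x * df).
Proof.
move=> fx; have -> : (fun t => f t ^+ 2) = (fun t => f t * f t) by [].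
by apply: (is_derive_eq (is_derive_fctM fx fx)); ring.
Qed.

Lemma is_derive_fctV f x df : is_derive x 1 f df -> f x != 0 ->
  is_derive x 1 (fun t => (f t)^-1) (- df / f x ^+ 2).
Proof.
move=> [fx dfx] fx0; apply: DeriveDef; first exact: derivableV.
by rewrite deriveV// dfx /GRing.scale /= mulrC mulNr mulrN.
Qed.

Lemma is_derive_fct_ln f x df : is_derive x 1 f df -> 0 < f x ->
  is_derive x 1 (fun t => ln (f t)) (df / f x).
Proof.
move=> dfx fx0; rewrite mulrC; have dln := is_derive1_ln fx0.
exact: is_derive1_comp.
Qed.

Lemma is_derive_fct_powR f x df (r : R) : is_derive x 1 f df -> 0 < f x ->
  is_derive x 1 (fun t => f t `^ r) (r * f x `^ (r - 1) * df).
Proof.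
move=> dfx fx0; have dp := is_derive1_powR r fx0.
exact: (@is_derive1_comp _ (fun t => t `^ r)).
Qed.

Lemma is_derive_fct_id x : is_derive x 1 (fun t => t) 1.
Proof. exact: is_derive_id. Qed.

Lemma is_derive_fct_cst (c x : R) : is_derive x 1 (fun=> c) 0.
Proof. exact: is_derive_cst. Qed.

Lemma mean_value_derivable f x y : x <= y ->
  (forall t, x <= t <= y -> derivable f t 1) ->
  exists2 t, x <= t <= y & f y - f x = 'D_1 f t * (y - x).
Proof.
move=> xy df; have [t txy E] : exists2 t, t \in `[x, y]%R &
    f y - f x = 'D_1 f t * (y - x).
  apply: MVT_segment => // [t|].
    by rewrite in_itv /= => /andP[xt ty]; apply/derivableP/df; rewrite !ltW.
  by apply: derivable_within_continuous => t; rewrite in_itv /=; exact: df.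
by exists t => //; move: txy; rewrite in_itv.
Qed.

Lemma ge0_derive_le f x y : x <= y ->
  (forall t, x <= t <= y -> exists2 d, is_derive t 1 f d & 0 <= d) ->
  f x <= f y.
Proof.
move=> xy fd; have df t : x <= t <= y -> derivable f t 1 by move=> /fd[d []].
have [t /fd[d dt d0] E] := mean_value_derivable xy df.
by rewrite -subr_ge0 E derive_val mulr_ge0// subr_ge0.
Qed.

Lemma gt0_derive_lt f x y : x < y ->
  (forall t, x <= t <= y -> exists2 d, is_derive t 1 f d & 0 < d) ->
  f x < f y.
Proof.
move=> xy fd; have df t : x <= t <= y -> derivable f t 1 by move=> /fd[d []].
have [t /fd[d dt d0] E] := mean_value_derivable (ltW xy) df.
by rewrite -subr_gt0 E derive_val mulr_gt0// subr_gt0.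
Qed.
End pointwise_derivatives.

(** Known derivatives come first: otherwise a function whose derivative is
available as a hypothesis would be unfolded. Instance search is bypassed because
it would pick the rules for sums and products in the space of functions, which
leave unreduced derivatives behind. *)
Ltac derive_step := first
  [ eassumption
  | notypeclasses refine (is_derive_fct_cst _ _)
  | notypeclasses refine (is_derive_fct_id _)
  | notypeclasses refine (is_derive_fctB _ _)
  | notypeclasses refine (is_derive_fctD _ _)
  | notypeclasses refine (is_derive_fctN _)
  | notypeclasses refine (is_derive_fct_sqr _)
  | notypeclasses refine (is_derive_fct_ln _ _)
  | notypeclasses refine (is_derive_fct_powR _ _ _)
  | notypeclasses refine (is_derive_fctV _ _)
  | notypeclasses refine (is_derive_fctM _ _)].
Ltac derive := notypeclasses refine (is_derive_eq _ _); [repeat derive_step..|].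

(** * Comparing the Bernstein exponent with the relative entropy *)

Section entropy_vs_bernstein.
Context {R : realType}.
Variables p beta : R.
Hypotheses (p0 : 0 < p) (p1 : p < 1).
Hypotheses (beta0 : 0 <= beta) (betaqp : 1 - 2 * p <= beta).

(** With [x = p + (1 - p) t] this is [K(x) / (1 - p)], where
[K(x) = p ln (p/x) + (1 - p) ln ((1 - p)/(1 - x))]. *)
Definition entropy_gain (t : R) : R :=
  - (p / (1 - p)) * ln (1 + (1 - p) / p * t) - ln (1 - t).
(** With [eps = (1 - p) t], the exponent of the theorem is [b + 1] times this
quantity; the factor [2/3] makes its derivative at most [t / (p + beta t)]. *)
Definition bernstein_gain (t : R) : R := t ^+ 2 / (2 * (p + 2 / 3 * beta * t)).
(** The factor [p + beta] normalizes the value at [t = 1] to [1]; it is the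
larger of [p] and [1 - p] when [beta] is the positive part of [1 - 2 p]. *)
Definition rel_sqr (t : R) : R := (p + beta) * t ^+ 2 / (p + beta * t).

Let c (t : R) := p + beta * t.

Let c_gt0 (t : R) : 0 <= t -> 0 < c t.
Proof. by move=> t0; rewrite ltr_wpDr// mulr_ge0. Qed.

Lemma is_derive_entropy_gain (t : R) : 0 <= t < 1 ->
  is_derive t 1 entropy_gain (t / ((1 - t) * (p + (1 - p) * t))).
Proof.
move=> /andP[t0 t1].
have d0 : 0 < p + (1 - p) * t by rewrite ltr_wpDr// mulr_ge0// subr_ge0 ltW.
have h : 0 < 1 + (1 - p) / p * t.
  have -> : 1 + (1 - p) / p * t = (p + (1 - p) * t) / p by field; rewrite gt_eqF.
  by rewrite divr_gt0.
rewrite /entropy_gain; derive => //=; first by rewrite subr_gt0.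
field; apply/and4P; split; rewrite ?gt_eqF ?subr_gt0//.
Qed.

Lemma is_derive_bernstein_gain (t : R) : 0 <= t ->
  is_derive t 1 bernstein_gain (t * (p + beta * t / 3) / (p + 2 / 3 * beta * t) ^+ 2).
Proof.
move=> t0.
have d0 : 0 < p + 2 / 3 * beta * t by rewrite ltr_wpDr// !mulr_ge0.
rewrite /bernstein_gain; derive => /=; first by rewrite gt_eqF// mulr_gt0.
field; rewrite gt_eqF//; nra.
Qed.

Lemma is_derive_rel_sqr (t : R) : 0 <= t ->
  is_derive t 1 rel_sqr ((p + beta) * t * (p + c t) / c t ^+ 2).
Proof.
move=> t0; have := c_gt0 t0; rewrite /c => c0.
rewrite /rel_sqr; derive => /=; first by rewrite gt_eqF.
field; rewrite gt_eqF//.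
Qed.

Lemma rel_sqr0 : rel_sqr 0 = 0.
Proof. by rewrite /rel_sqr expr0n /= mulr0 mul0r. Qed.

Lemma rel_sqr_ge0 (t : R) : 0 <= t -> 0 <= rel_sqr t.
Proof.
move=> t0; have := c_gt0 t0; rewrite /rel_sqr /c => c0; have pge0 := ltW p0.
by rewrite divr_ge0 ?(ltW c0)// mulr_ge0 ?sqr_ge0// addr_ge0.
Qed.

Lemma rel_sqr_lt1 (t : R) : 0 <= t < 1 -> rel_sqr t < 1.
Proof.
move=> /andP[t0 t1]; have c0 := c_gt0 t0.
rewrite /rel_sqr ltr_pdivrMr// mul1r.
have h1 : p * t ^+ 2 < p by rewrite gtr_pMr// expr_lt1.
have h2 : beta * t ^+ 2 <= beta * t by rewrite expr2 ler_wpM2l// ler_piMl// ltW.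
by rewrite mulrDl ltr_leD.
Qed.

Lemma rel_sqr_homo (s t : R) : 0 <= s -> s <= t -> rel_sqr s <= rel_sqr t.
Proof.
move=> s0 st; have t0 := le_trans s0 st.
rewrite /rel_sqr ler_pdivrMr ?c_gt0// mulrAC ler_pdivlMr ?c_gt0//.
rewrite -subr_ge0 /c.
have -> : (p + beta) * t ^+ 2 * (p + beta * s) - (p + beta) * s ^+ 2 * (p + beta * t) =
  (p + beta) * (p * (t ^+ 2 - s ^+ 2) + beta * (s * (t * (t - s)))) by ring.
have h1 : 0 <= t ^+ 2 - s ^+ 2 by rewrite subr_ge0 ler_sqr.
have pge0 := ltW p0; apply: mulr_ge0; first exact: addr_ge0.
by apply: addr_ge0; rewrite !mulr_ge0 // subr_ge0.
Qed.

(** The denominator on the left is [c t - (p + beta) t^2], and it exceeds the one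
on the right by [(beta - (1 - 2 p)) t (1 - t)]. *)
Lemma entropy_speed (t : R) : 0 <= t < 1 ->
  t / c t / (1 - rel_sqr t) <= t / ((1 - t) * (p + (1 - p) * t)).
Proof.
move=> /andP[t0 t1]; have c0 := c_gt0 t0.
have d0 : 0 < p + (1 - p) * t by rewrite ltr_wpDr// mulr_ge0// subr_ge0 ltW.
have E : c t * (1 - rel_sqr t) = c t - (p + beta) * t ^+ 2.
  by rewrite /rel_sqr -/(c t); field; rewrite gt_eqF.
rewrite -mulrA -invfM ler_wpM2l// lef_pV2 ?posrE; last 2 first.
- by rewrite mulr_gt0// subr_gt0 rel_sqr_lt1// t0.
- by rewrite mulr_gt0// subr_gt0.
rewrite E /c -subr_ge0.
have -> : p + beta * t - (p + beta) * t ^+ 2 - (1 - t) * (p + (1 - p) * t) =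
  (beta - (1 - 2 * p)) * (t * (1 - t)) by ring.
by rewrite mulr_ge0// ?mulr_ge0// subr_ge0// ltW.
Qed.

(** After clearing denominators the two sides differ by [(beta t)^2 / 9]: the
linear terms in [beta t] cancel because of the factor [2/3]. *)
Lemma bernstein_speed (t : R) : 0 <= t ->
  t * (p + beta * t / 3) / (p + 2 / 3 * beta * t) ^+ 2 <= t / c t.
Proof.
move=> t0; have c0 := c_gt0 t0.
have d0 : 0 < p + 2 / 3 * beta * t by rewrite ltr_wpDr// !mulr_ge0.
rewrite -mulrA ler_wpM2l// ler_pdivrMr ?exprn_gt0// [leRHS]mulrC ler_pdivlMr//.
rewrite /c -subr_ge0.
have -> : (p + 2 / 3 * beta * t) ^+ 2 - (p + beta * t / 3) * (p + beta * t) =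
  (beta * t) ^+ 2 / 9 by field.
by rewrite divr_ge0// sqr_ge0.
Qed.

(** It amounts to [c <= M (p + c)] with [M = p + beta], which follows from
[c <= M] and [M + p >= 1]. *)
Lemma rel_sqr_speed (t : R) : 0 <= t <= 1 ->
  t / c t <= (p + beta) * t * (p + c t) / c t ^+ 2.
Proof.
move=> /andP[t0 t1]; have c0 := c_gt0 t0.
have -> : t / c t = t * c t / c t ^+ 2 by field; rewrite gt_eqF.
rewrite ler_wpM2r ?invr_ge0 ?sqr_ge0// -mulrA mulrCA ler_wpM2l//.
have cM : c t <= p + beta by rewrite /c lerD2l ler_piMr.
have M0 : 0 < p + beta by rewrite ltr_wpDr.
have Mp : 0 <= p + beta - (1 - p) by move: betaqp; lra.
have [M1|M1] := leP 1 (p + beta).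
  apply: le_trans (_ : 1 * (p + c t) <= _); first by rewrite mul1r lerDr ltW.
  by rewrite ler_wpM2r// ltW// addr_gt0.
have h1 : 0 <= (1 - (p + beta)) * (p + beta - c t) by rewrite mulr_ge0 ?subr_ge0// ltW.
have h2 := mulr_ge0 (ltW M0) Mp.
lra.
Qed.

Lemma entropy_gain0 : entropy_gain 0 = 0.
Proof. by rewrite /entropy_gain mulr0 addr0 subr0 ln1; lra. Qed.

Lemma bernstein_gain0 : bernstein_gain 0 = 0.
Proof. by rewrite /bernstein_gain expr0n mul0r. Qed.

Lemma bernstein_le_entropy (t : R) : 0 <= t < 1 ->
  bernstein_gain t <= entropy_gain t.
Proof.
move=> /andP[t0 t1]; rewrite -subr_ge0.
have -> : 0 = entropy_gain 0 - bernstein_gain 0.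
  by rewrite entropy_gain0 bernstein_gain0 subrr.
apply: (ge0_derive_le (f := fun t => entropy_gain t - bernstein_gain t)) => //.
move=> s /andP[s0 st]; have s01 : 0 <= s < 1 by rewrite s0 (le_lt_trans st).
have dE := is_derive_entropy_gain s01; have dB := is_derive_bernstein_gain s0.
eexists; first by repeat derive_step.
rewrite subr_ge0 (le_trans (bernstein_speed s0))// (le_trans _ (entropy_speed s01))//.
have c0 := c_gt0 s0; have u1 := rel_sqr_lt1 s01.
rewrite ler_peMr ?divr_ge0 ?(ltW c0)// invf_ge1 ?subr_gt0//.
by rewrite gerBl rel_sqr_ge0.
Qed.

(** As long as [u = rel_sqr] is at most [1/2], the derivative of
[entropy_gain - 2 bernstein_gain] is at least [(t/c) (1/(1-u) - 2)], a
nonpositive multiple of [t/c <= u']; it is therefore at least the derivative of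
[- 2u - ln (1-u)]. The latter function is minimal at [u = 1/2]. *)
Lemma gain_gap_small (t : R) : 0 <= t < 1 -> rel_sqr t <= 2^-1 ->
  2 * bernstein_gain t <= entropy_gain t + (1 - ln 2).
Proof.
move=> /andP[t0 t1] ut.
have u1 : rel_sqr t < 1 by apply: rel_sqr_lt1; rewrite t0.
pose Q t := entropy_gain t - 2 * bernstein_gain t + (2 * rel_sqr t + ln (1 - rel_sqr t)).
have : Q 0 <= Q t.
  apply: (ge0_derive_le (f := Q)) => //.
  move=> s /andP[s0 st]; have s01 : 0 <= s < 1 by rewrite s0 (le_lt_trans st).
  have dE := is_derive_entropy_gain s01; have dB := is_derive_bernstein_gain s0.
  have dU := is_derive_rel_sqr s0.
  eexists; first by rewrite /Q; repeat derive_step; rewrite subr_gt0 rel_sqr_lt1.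
  have s01' : 0 <= s <= 1 by rewrite s0 (le_trans st)// ltW.
  have c0 := c_gt0 s0; have v1 := rel_sqr_lt1 s01.
  have v2 : rel_sqr s <= 2^-1 by rewrite (le_trans (rel_sqr_homo s0 st)).
  have H1 := entropy_speed s01; have H2 := bernstein_speed s0.
  have H3 := rel_sqr_speed s01'.
  have V2 : (1 - rel_sqr s)^-1 <= 2 by rewrite invf_ple ?posrE ?subr_gt0//; lra.
  (* The derivative dominates [(u' - s/c) (2 - 1/(1-u))]. *)
  move: H3 V2; rewrite -subr_ge0 => H3; rewrite -subr_ge0 => /(mulr_ge0 H3).
  move: H1 H2; move: (s / c s) => L; move: (1 - rel_sqr s)^-1 => V /=; lra.
have -> : Q 0 = 0.
  by rewrite /Q entropy_gain0 bernstein_gain0 rel_sqr0 !mulr0 !subr0 ln1 !addr0.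
have L : ln (2 * (1 - rel_sqr t)) <= 1 - 2 * rel_sqr t.
  have := @le_ln1Dx R (1 - 2 * rel_sqr t).
  have -> : 1 + (1 - 2 * rel_sqr t) = 2 * (1 - rel_sqr t) by ring.
  apply; lra.
move: L; rewrite lnM ?posrE ?subr_gt0// /Q; lra.
Qed.

(** Once [u >= 1/2], the lower bound [(t/c) (1/(1-u) - 2)] for the derivative of
[entropy_gain - 2 bernstein_gain] is nonnegative, so the estimate at the point
where [u = 1/2] propagates to the right. *)
Lemma gain_gap (t : R) : 0 <= t < 1 ->
  2 * bernstein_gain t <= entropy_gain t + (1 - ln 2).
Proof.
move=> /andP[t0 t1]; have t01 : 0 <= t < 1 by rewrite t0.
have [|ut] := leP (rel_sqr t) (2^-1); first exact: gain_gap_small.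
have [r] : exists2 r, r \in `[0, t]%R & rel_sqr r = 2^-1.
  apply: IVT => //.
    apply: derivable_within_continuous => s; rewrite in_itv/= => /andP[s0 _].
    by case: (is_derive_rel_sqr s0).
  rewrite ge_min le_max rel_sqr0 invr_ge0 ler0n/=.
  by rewrite (ltW ut) orbT.
rewrite in_itv/= => /andP[r0 rt] ur.
have : 2 * bernstein_gain r <= entropy_gain r + (1 - ln 2).
  by apply: gain_gap_small; rewrite ?r0 ?ur//= (le_lt_trans rt).
have : entropy_gain r - 2 * bernstein_gain r <= entropy_gain t - 2 * bernstein_gain t.
  apply: (ge0_derive_le (f := fun t => entropy_gain t - 2 * bernstein_gain t)) => //.
  move=> s /andP[rs st]; have s0 := le_trans r0 rs.
  have s01 : 0 <= s < 1 by rewrite s0 (le_lt_trans st).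
  have dE := is_derive_entropy_gain s01; have dB := is_derive_bernstein_gain s0.
  eexists; first by repeat derive_step.
  have us : 2^-1 <= rel_sqr s by rewrite -ur rel_sqr_homo.
  have c0 := c_gt0 s0; have v1 := rel_sqr_lt1 s01.
  have H1 := entropy_speed s01; have H2 := bernstein_speed s0.
  have V2 : 2 <= (1 - rel_sqr s)^-1 by rewrite invf_pge ?posrE ?subr_gt0//; lra.
  have L0 : 0 <= s / c s by rewrite divr_ge0// ltW.
  have := ler_wpM2l L0 V2.
  move: H1 H2; move: (s / c s) => L; move: (1 - rel_sqr s)^-1 => V /=; lra.
lra.
Qed.

(** The difference [b * entropy_gain - (b + 1) * bernstein_gain] is nondecreasing
in [b] since [bernstein_gain <= entropy_gain], so the case [b = 1] decides. *)
Lemma bernstein_le_entropy_scaled (b t : R) : 1 <= b -> 0 <= t < 1 ->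
  (b + 1) * bernstein_gain t <= b * entropy_gain t + (1 - ln 2).
Proof.
move=> b1 t01; have := gain_gap t01; have h := bernstein_le_entropy t01.
have : (b - 1) * bernstein_gain t <= (b - 1) * entropy_gain t.
  by rewrite ler_wpM2l// subr_ge0.
lra.
Qed.
End entropy_vs_bernstein.

(** * Distribution functions of beta type *)

Section auxiliary.
Context {R : realType}.
Implicit Types (A C e : R).
(** Replaces every passage to the limit at the endpoints [0] and [1] below. *)
Lemma le0_of_linear_bound A C e0 : 0 <= C -> 0 < e0 ->
  (forall e, 0 < e < e0 -> A <= C * e) -> A <= 0.
Proof.
move=> C0 e00 AC; rewrite leNgt; apply/negP => A0.
have C1 : 0 < C + 1 by rewrite ltr_wpDl.
pose e := Num.min (e0 / 2) (A / (C + 1)).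
have ee : 0 < e by rewrite lt_min !divr_gt0.
have ee0 : e < e0 by rewrite gt_min ltr_pdivrMr// ltr_pMr// ltr1n.
have := AC e; rewrite ee ee0 => /(_ isT).
have : e * (C + 1) <= A by rewrite -ler_pdivlMr// ge_min lexx orbT.
by lra.
Qed.

Lemma powRB1 (x r : R) : 0 < x -> x `^ (r - 1) = x `^ r / x.
Proof. by move=> x0; rewrite powRB ?powRr1 ?ltW// (gt_eqF x0) implybT. Qed.
End auxiliary.

(** What the tail estimates use of a distribution function with density [c * x^(a-1)
(1-x)^(b-1)]. The linear bounds hold because the density is at most [c]; they give
the limits at the endpoints, so that no function has to be studied at [0] or [1],
where the real powers may fail to be continuous. *)
Record beta_cdf (R : realType) (a b c : R) (Phi : R -> R) : Prop := BetaCdf {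
  beta_cdf_scale_gt0 : 0 < c ;
  beta_cdf_derive : forall x : R, 0 < x < 1 ->
    is_derive x 1 Phi (c * beta_weight a b x) ;
  beta_cdf_left : forall x : R, 0 < x < 1 -> 0 <= Phi x <= c * x ;
  beta_cdf_right : forall x : R, 0 < x < 1 -> 0 <= 1 - Phi x <= c * (1 - x) }.

Section beta_tail.
Context {R : realType}.
Variables (a b c : R) (Phi : R -> R).
Hypotheses (a1 : 1 <= a) (b1 : 1 <= b) (Phi_cdf : beta_cdf a b c Phi).
Implicit Types m x y z t e : R.

Let f x := c * beta_weight a b x.
(** The density multiplied by [x (1 - x)], the Stein kernel of the beta law up to
a constant: its derivative is [(a + b) (p - x)] times the density, where [p] is the
mean. *)
Definition stein_weight x := c * (x `^ a * (1 - x) `^ b).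
Local Notation G := stein_weight.

Let a0 : 0 < a. Proof. exact: lt_le_trans a1. Qed.
Let b0 : 0 < b. Proof. exact: lt_le_trans b1. Qed.
Let c0 : 0 < c. Proof. exact: beta_cdf_scale_gt0 Phi_cdf. Qed.

Let f_gt0 x : 0 < x < 1 -> 0 < f x.
Proof.
by move=> /andP[x0 x1]; rewrite /f /beta_weight !mulr_gt0// powR_gt0// subr_gt0.
Qed.

Lemma stein_weightE x : 0 < x < 1 ->
  G x = x * (1 - x) * (c * beta_weight a b x).
Proof.
move=> /andP[x0 x1]; have y0 : 0 < 1 - x by rewrite subr_gt0.
rewrite /stein_weight /beta_weight !powRB1//.
by field; rewrite !gt_eqF.
Qed.

Lemma stein_weight_gt0 x : 0 < x < 1 -> 0 < G x.
Proof.
move=> x01; rewrite stein_weightE//; have fx := f_gt0 x01.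
by case/andP: x01 => x0 x1; apply: mulr_gt0 => //; rewrite mulr_gt0// subr_gt0.
Qed.

Lemma is_derive_stein_weight x : 0 < x < 1 ->
  is_derive x 1 G ((a - (a + b) * x) * (c * beta_weight a b x)).
Proof.
move=> /andP[x0 x1]; have y0 : 0 < 1 - x by rewrite subr_gt0.
rewrite /stein_weight; derive => //=.
rewrite /beta_weight !powRB1//.
by field; rewrite !gt_eqF.
Qed.

Let dPhi x : 0 < x < 1 -> is_derive x 1 Phi (c * beta_weight a b x).
Proof. exact: beta_cdf_derive Phi_cdf x. Qed.

Let between x y t : 0 < x -> y < 1 -> x <= t <= y -> 0 < t < 1.
Proof.
by move=> x0 y1 /andP[xt ty]; rewrite (lt_le_trans x0 xt) (le_lt_trans ty y1).
Qed.

(** The derivative is [- (a + b) (1 - Phi x) <= 0], because the two terms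
containing the density cancel, and the expression tends to [0] at [1]. *)
Lemma stein_tail_ge0 x : 0 < x < 1 ->
  0 <= G x + (a - (a + b) * x) * (1 - Phi x).
Proof.
move=> /andP[x0 x1]; rewrite -oppr_le0.
apply: (@le0_of_linear_bound _ _ (b * c) (1 - x)) => [||e /andP[e0 ex]].
- by rewrite mulr_ge0// ltW.
- by rewrite subr_gt0.
pose V z := - (G z + (a - (a + b) * z) * (1 - Phi z)).
have xy : x <= 1 - e by rewrite lerBrDl -lerBrDr ltW.
have y1 : 1 - e < 1 by rewrite gtrBl.
have y01 : 0 < 1 - e < 1 by rewrite y1 (lt_le_trans x0).
apply: (@le_trans _ _ (V (1 - e))).
  apply: (ge0_derive_le (f := V)) => // t /(between x0 y1) t01.
  have dP := dPhi t01; have dG := is_derive_stein_weight t01.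
  eexists; first by rewrite /V; repeat derive_step.
  have /andP[F0 _] := beta_cdf_right Phi_cdf t01.
  have := mulr_ge0 (ltW (addr_gt0 a0 b0)) F0.
  by rewrite /= ; lra.
have /andP[F0 F1] := beta_cdf_right Phi_cdf y01.
have G0 := stein_weight_gt0 y01.
have h1 : 0 <= b * (c * (1 - (1 - e)) - (1 - Phi (1 - e))).
  by rewrite mulr_ge0 ?subr_ge0// ltW.
have h2 := mulr_ge0 (mulr_ge0 (ltW (addr_gt0 a0 b0)) (ltW e0)) F0.
rewrite /V; lra.
Qed.

(** The derivative of the quotient is [- f / G^2] times the quantity of
[stein_tail_ge0]. As [stein_weight] is proportional to [exp (- (a + b) K)], this
is the exponential decay of the tail at the rate of the relative entropy. *)
Lemma tail_over_stein_weight_nincr x y : 0 < x -> x <= y -> y < 1 ->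
  (1 - Phi y) / G y <= (1 - Phi x) / G x.
Proof.
move=> x0 xy y1; rewrite -lerN2.
apply: (ge0_derive_le (f := fun z => - ((1 - Phi z) / G z))) => //.
move=> t /(between x0 y1) t01.
have dP := dPhi t01; have dG := is_derive_stein_weight t01.
have G0 := stein_weight_gt0 t01.
eexists; first by repeat derive_step; rewrite gt_eqF.
have := stein_tail_ge0 t01; rewrite /= -/(f t) => V0.
rewrite [leRHS](_ : _ = f t * (G t + (a - (a + b) * t) * (1 - Phi t)) / G t ^+ 2).
  by rewrite divr_ge0 ?sqr_ge0// mulr_ge0// ltW// f_gt0.
by field; rewrite gt_eqF.
Qed.

Lemma beta_cdf_gt0 x : 0 < x < 1 -> 0 < Phi x.
Proof.
move=> /andP[x0 x1]; have y0 : 0 < x / 2 by rewrite divr_gt0.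
have yx : x / 2 < x by rewrite ltr_pdivrMr// ltr_pMr// ltr1n.
have y01 : 0 < x / 2 < 1 by rewrite y0 (lt_trans yx).
have /andP[Phi0 _] := beta_cdf_left Phi_cdf y01.
apply: le_lt_trans Phi0 _; apply: gt0_derive_lt => // t /(between y0 x1) t01.
by exists (f t); [exact: dPhi | exact: f_gt0].
Qed.

Lemma beta_cdf_le1 x : 0 < x < 1 -> Phi x <= 1.
Proof. by move=> /(beta_cdf_right Phi_cdf)/andP[]; rewrite subr_ge0. Qed.

(** The factor [k] of [Phi x] satisfies [(x f)' = k f]; it is nonincreasing because
[b >= 1], so the derivative of the whole expression is
[(b - 1) / (1 - x)^2 * Phi x >= 0], and the expression tends to [0] at [0]. *)
Lemma elasticity_ge0 x : 0 < x < 1 ->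
  0 <= x * f x - (a - (b - 1) * x / (1 - x)) * Phi x.
Proof.
move=> /andP[x0 x1]; rewrite -oppr_le0.
apply: (@le0_of_linear_bound _ _ (a * c) x) => // [|y /andP[y0 yx]].
  by rewrite mulr_ge0// ltW.
pose V z := c * (z `^ a * (1 - z) `^ (b - 1)) - (a - (b - 1) * z / (1 - z)) * Phi z.
have VE z : 0 < z < 1 -> V z = z * f z - (a - (b - 1) * z / (1 - z)) * Phi z.
  move=> /andP[z0 z1]; have z1' : 0 < 1 - z by rewrite subr_gt0.
  by rewrite /V /f /beta_weight !powRB1//; field; rewrite !gt_eqF.
have y1 := lt_trans yx x1.
rewrite -VE ?x0// (@le_trans _ _ (- V y))//.
  rewrite lerN2; apply: (ge0_derive_le (f := V)); first exact: ltW.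
  move=> t /(between y0 x1) t01; have dP := dPhi t01.
  case/andP: (t01) => t0 t1; have t1' : 0 < 1 - t by rewrite subr_gt0.
  eexists; first by rewrite /V; repeat derive_step; rewrite ?gt_eqF.
  rewrite [leRHS](_ : _ = (b - 1) * Phi t / (1 - t) ^+ 2).
    by rewrite divr_ge0 ?sqr_ge0// mulr_ge0 ?subr_ge0// ltW// beta_cdf_gt0.
  by rewrite /= /beta_weight !powRB1//; field; rewrite !gt_eqF.
have y01 : 0 < y < 1 by rewrite y0.
rewrite VE// opprB lerBlDr; have /andP[P0 P1] := beta_cdf_left Phi_cdf y01.
have h1 : 0 <= y * f y by rewrite mulr_ge0// ltW// f_gt0.
have h2 : 0 <= (b - 1) * y / (1 - y) * Phi y.
  by rewrite mulr_ge0// divr_ge0// ?mulr_ge0 ?subr_ge0// ltW.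
have := ler_wpM2l (ltW a0) P1; lra.
Qed.

(** The elasticity [x f / Phi] is the slope of [ln Phi] as a function of [ln x];
that it decreases means that [ln Phi] is concave in [ln x]. *)
Lemma elasticity_nincr x y : 0 < x -> x <= y -> y < 1 ->
  y * f y / Phi y <= x * f x / Phi x.
Proof.
move=> x0 xy y1; rewrite -lerN2.
have E z : 0 < z < 1 -> z * f z = c * (z `^ a * (1 - z) `^ (b - 1)).
  move=> /andP[z0 z1]; have z1' : 0 < 1 - z by rewrite subr_gt0.
  by rewrite /f /beta_weight !powRB1//; field; rewrite !gt_eqF.
rewrite !E ?x0 ?y1 ?(le_lt_trans xy) ?(lt_le_trans x0)//.
apply: (ge0_derive_le
  (f := fun z => - (c * (z `^ a * (1 - z) `^ (b - 1)) / Phi z))) => //.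
move=> t /(between x0 y1) t01; have dP := dPhi t01.
have P0 := beta_cdf_gt0 t01; have := elasticity_ge0 t01.
case/andP: (t01) => t0 t1; have t1' : 0 < 1 - t by rewrite subr_gt0.
move=> V0; eexists; first by repeat derive_step; rewrite ?gt_eqF.
rewrite [leRHS](_ : _ =
  f t * (t * f t - (a - (b - 1) * t / (1 - t)) * Phi t) / Phi t ^+ 2).
  by rewrite divr_ge0 ?sqr_ge0// mulr_ge0// ltW// f_gt0.
rewrite /= /f /beta_weight !powRB1//; field; rewrite !gt_eqF//.
Qed.

(** Concavity in [ln x] puts [ln Phi] below its tangent in that variable, whose
slope [l] is nonnegative; then [ln x - ln m <= (x - m) / m]. *)
Lemma ln_beta_cdf_tangent m x : 0 < m < 1 -> 0 < x < 1 ->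
  ln (Phi x) <= ln (Phi m) + f m / Phi m * (x - m).
Proof.
move=> m01 x01; case/andP: (m01) => m0 m1; case/andP: (x01) => x0 x1.
pose l := m * f m / Phi m.
have l0 : 0 <= l.
  by rewrite /l divr_ge0 ?(ltW (beta_cdf_gt0 _))// mulr_ge0 ?(ltW (f_gt0 _))// ltW.
have dT (t : R) : 0 < t < 1 -> is_derive t 1 (fun z => ln (Phi z) - l * ln z)
    (t^-1 * (t * f t / Phi t - l)).
  move=> t01; have dP := dPhi t01; have P0 := beta_cdf_gt0 t01.
  case/andP: (t01) => t0 t1; derive => //=; rewrite /f; field.
  by rewrite !gt_eqF.
have : ln (Phi x) - l * ln x <= ln (Phi m) - l * ln m.
  have [xm|/ltW mx] := leP x m.
    apply: (ge0_derive_le (f := fun z => ln (Phi z) - l * ln z)) => // t txm.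
    have t01 := between x0 m1 txm; exists (t^-1 * (t * f t / Phi t - l)); first exact: dT.
    case/andP: (t01) => t0 t1; case/andP: txm => xt tm.
    by rewrite mulr_ge0 ?invr_ge0 ?(ltW t0)// subr_ge0 elasticity_nincr.
  rewrite -lerN2; apply: (ge0_derive_le
    (f := fun z => - (ln (Phi z) - l * ln z))) => // t txm.
  have t01 := between m0 x1 txm; exists (- (t^-1 * (t * f t / Phi t - l))).
    by have := dT _ t01 => ?; derive_step.
  case/andP: (t01) => t0 t1; case/andP: txm => mt tx.
  by rewrite oppr_ge0 mulr_ge0_le0 ?invr_ge0 ?(ltW t0)// subr_le0 elasticity_nincr.
have : ln x - ln m <= (x - m) / m.
  rewrite -ln_div ?posrE//; have := @le_ln1Dx R ((x - m) / m).
  have -> : 1 + (x - m) / m = x / m by field; rewrite gt_eqF.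
  by apply; rewrite ltr_pdivlMr// mulN1r ltrBrDr addrC subrr.
move=> /(ler_wpM2l l0).
have -> : l * ((x - m) / m) = f m / Phi m * (x - m).
  by rewrite /l; field; rewrite !gt_eqF// beta_cdf_gt0.
lra.
Qed.

(** Jensen's inequality [ln Phi(p) >= E (ln Phi(X)) = -1] in integrated form.
The function [Q] below is a primitive of
[f * (ln Phi - ln Phi(p) - mu (x - p))], which is nonpositive by the tangent
bound: [Phi ln Phi - Phi] is a primitive of [f ln Phi], and the Stein weight
provides a primitive of [(x - p) f] that vanishes at both ends, which is how the
mean enters. So [Q] decreases from [0] to [- 1 - ln Phi(p)]. *)
Lemma beta_cdf_mean_ge : expR (-1) <= Phi (a / (a + b)).
Proof.
have ab0 : 0 < a + b by rewrite addr_gt0.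
set p := a / (a + b).
have p01 : 0 < p < 1 by rewrite divr_gt0//= ltr_pdivrMr// mul1r ltrDl.
have P0 := beta_cdf_gt0 p01; have P1 := beta_cdf_le1 p01.
rewrite -[leRHS]lnK ?posrE// ler_expR -subr_le0.
pose L := ln (Phi p); have L0 : L <= 0 by exact: ln_le0.
pose mu := f p / Phi p; have mu0 : 0 <= mu by rewrite divr_ge0// ltW// f_gt0.
have nu0 : 0 <= mu / (a + b) := divr_ge0 mu0 (ltW ab0).
have Lc0 : 0 <= - L * c by rewrite mulr_ge0 ?(ltW c0)// oppr_ge0.
pose Q z := Phi z * ln (Phi z) - Phi z - L * Phi z + mu / (a + b) * G z.
have Q_nincr x y : 0 < x -> x <= y -> y < 1 -> Q y <= Q x.
  move=> x0 xy y1; rewrite -lerN2.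
  apply: (ge0_derive_le (f := fun z => - Q z)) => // t /(between x0 y1) t01.
  have dP := dPhi t01; have dG := is_derive_stein_weight t01.
  have Pt := beta_cdf_gt0 t01.
  eexists; first by rewrite /Q; repeat derive_step.
  rewrite [leRHS](_ : _ = f t * (L + mu * (t - p) - ln (Phi t))); last first.
    by rewrite /p /= -/(f t); field; rewrite !gt_eqF.
  by rewrite mulr_ge0 ?(ltW (f_gt0 _))// subr_ge0 ln_beta_cdf_tangent.
have Q_le0 x : 0 < x < 1 -> Q x <= 0.
  move=> /andP[x0 x1].
  apply: (@le0_of_linear_bound _ _ (- L * c + mu / (a + b) * c) x) => //
    [|y /andP[y0 yx]].
    exact: (addr_ge0 Lc0 (mulr_ge0 nu0 (ltW c0))).
  have y1 := lt_trans yx x1; have y01 : 0 < y < 1 by rewrite y0.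
  apply: le_trans (Q_nincr _ _ y0 (ltW yx) x1) _.
  have /andP[Py0 Pyc] := beta_cdf_left Phi_cdf y01.
  have h1 : Phi y * ln (Phi y) <= 0 by rewrite mulr_ge0_le0// ln_le0// beta_cdf_le1.
  have h2 : - L * Phi y <= - L * (c * y) by rewrite ler_wpM2l// oppr_ge0.
  have h3 : G y <= c * y.
    rewrite /stein_weight ler_wpM2l ?(ltW c0)//.
    rewrite -[leRHS]mulr1 ler_pM ?powR_ge0//.
      by rewrite ge1r_powR// y0 ltW.
    have := @ge0_ler_powR R b (ltW b0) (1 - y) 1; rewrite powR1; apply.
    - by rewrite nnegrE subr_ge0 ltW.
    - by rewrite nnegrE.
    - by rewrite gerBl ltW.
  have h4 : mu / (a + b) * G y <= mu / (a + b) * (c * y).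
    by rewrite ler_wpM2l.
  rewrite /Q; lra.
apply: (@le0_of_linear_bound _ _ (- L * c) 1) => // e /andP[e0 e1].
have y01 : 0 < 1 - e < 1 by rewrite subr_gt0 e1 gtrBl.
have := Q_le0 _ y01; have Py := beta_cdf_gt0 y01.
have /andP[F0 F1] := beta_cdf_right Phi_cdf y01.
(* From [ln (1/y) <= 1/y - 1] at [y = Phi (1 - e)]. *)
have h1 : Phi (1 - e) - 1 <= Phi (1 - e) * ln (Phi (1 - e)).
  have := @le_ln1Dx R ((Phi (1 - e))^-1 - 1).
  rewrite subrKC lnV ?posrE// => /(_ _)/(ler_wpM2l (ltW Py)).
  rewrite mulrBr divff ?gt_eqF// mulr1 mulrN.
  have -> : -1 < (Phi (1 - e))^-1 - 1 by rewrite ltrBrDr addNr invr_gt0.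
  by move=> /(_ isT); lra.
have h2 := mulr_ge0 nu0 (ltW (stein_weight_gt0 y01)).
have h3 : - L * (1 - Phi (1 - e)) <= - L * (c * (1 - (1 - e))).
  by rewrite ler_wpM2l// oppr_ge0.
rewrite /Q -/L; lra.
Qed.
End beta_tail.

(** * The distribution function of a random variable with a beta law *)

Section beta_law.
Context {R : realType} {d : measure_display} {T : measurableType d}.
Variables (P : probability T R) (X : {RV P >-> R}) (a b : R).
Hypotheses (a1 : 1 <= a) (b1 : 1 <= b) (hX : has_beta_law X a b).
Local Notation mu := (@lebesgue_measure R).
Local Notation f := (beta_density a b).
Local Notation c := (beta_norm a b)^-1.
Implicit Types x u v : R.

Let w_ge0 x : 0 <= beta_weight a b x.
Proof. by rewrite mulr_ge0 ?powR_ge0. Qed.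

Let norm_ge0 : 0 <= beta_norm a b.
Proof. by apply: Rintegral_ge0 => x _; exact: w_ge0. Qed.

Let fE x : 0 < x < 1 -> f x = c * beta_weight a b x.
Proof.
move=> x01; rewrite /beta_density patchE mem_set; last by rewrite /= in_itv.
by rewrite mulrC.
Qed.

Let f0 x : ~~ (0 < x < 1) -> f x = 0.
Proof.
move=> x01; rewrite /beta_density patchE memNset//.
by rewrite /= in_itv; exact/negP.
Qed.

Let f_ge0 x : 0 <= f x.
Proof.
have [/fE ->|/f0 -> //] := boolP (0 < x < 1).
by rewrite mulr_ge0 ?invr_ge0.
Qed.

Let f_le x : f x <= c.
Proof.
have [x01|/f0 -> //] := boolP (0 < x < 1); last by rewrite invr_ge0.
rewrite fE// ler_piMr ?invr_ge0//; case/andP: x01 => x0 x1.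
have le1 (y r : R) : 0 < y -> y < 1 -> 1 <= r -> y `^ (r - 1) <= 1.
  move=> y0 y1 r1; have := @ge0_ler_powR R (r - 1) _ y 1.
  by rewrite subr_ge0 powR1 !nnegrE => /(_ r1); apply => //; exact: ltW.
by rewrite mulr_ile1 ?powR_ge0 ?le1 ?subr_gt0 ?gtrBl.
Qed.

Let mf : measurable_fun [set: R] f.
Proof.
rewrite /beta_density; apply/(measurable_restrict _ _ _) => //.
rewrite setTI; apply: measurable_funM => //.
apply: measurable_funTS; apply: measurable_funM; first exact: measurable_powR.
apply: (measurableT_comp (measurable_powR _)).
exact: measurable_funB.
Qed.

Let total : (\int[mu]_x (f x)%:E = 1)%E.
Proof. by rewrite -hX// probability_setT. Qed.

(** If the normalizing constant were [0], the density, being a quotient by it,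
would vanish identically, whereas its total mass is [1]. *)
Let norm_gt0 : 0 < beta_norm a b.
Proof.
rewrite lt_neqAle norm_ge0 andbT; apply/eqP => B0.
have := total; rewrite integral0_eq.
  by move/eqP; rewrite eqe eq_sym oner_eq0.
move=> x _; have [/fE ->|/f0 -> //] := boolP (0 < x < 1).
by rewrite -B0 invr0 mul0r.
Qed.

Let integrable_f : mu.-integrable [set: R] (EFin \o f).
Proof.
apply/integrableP; split; first exact/measurable_EFinP.
under eq_integral => x _ do rewrite /= ger0_norm//.
by rewrite total ltry.
Qed.

Let mass_le (A : set R) u v : measurable A -> u <= v ->
  (forall x, A x -> 0 < x < 1 -> u <= x <= v) ->
  (\int[mu]_(x in A) (f x)%:E <= (c * (v - u))%:E)%E.
Proof.
move=> mA uv Auv.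
apply: (@le_trans _ _ (\int[mu]_(x in A) ((cst c \_ `[u, v]) x)%:E)%E).
  apply: ge0_le_integral => //.
  - by move=> x _; rewrite lee_fin.
  - exact/measurable_EFinP/measurable_funTS.
  - apply/measurable_EFinP/measurable_funTS.
    by apply/(measurable_restrict _ _ _) => //.
  - move=> x Ax; rewrite lee_fin.
    have [x01|/f0 ->] := boolP (0 < x < 1).
      by rewrite patchE ifT ?f_le// inE /= in_itv /= Auv.
    by rewrite patchE; case: ifP => // _; rewrite invr_ge0.
rewrite -[X in (X <= _)%E](_ : (\int[mu]_(x in A `&` `[u, v]) c%:E)%E = _); last first.
  rewrite integral_mkcondr; apply: eq_integral => x _.
  by rewrite !patchE; case: ifP.
rewrite integral_cst; last exact: measurableI.
rewrite EFinM lee_wpmul2l ?lee_fin ?invr_ge0//.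
apply: le_trans (_ : mu `[u, v] <= _)%E.
  by apply: le_measure; rewrite ?inE//; exact: measurableI.
by rewrite lebesgue_measure_itv /= lte_fin; case: ifPn => // _; rewrite lee_fin subr_ge0.
Qed.

Definition beta_law_cdf x : R := \int[mu]_(t in `]-oo, x]) f t.

Let tailE x : P [set w | x <= X w] = (\int[mu]_(t in `[x, +oo[) (f t)%:E)%E.
Proof.
rewrite -hX//; rewrite /distribution /pushforward /=; congr (P _).
by apply/seteqP; split=> w /=; rewrite in_itv /= andbT.
Qed.

(** Closed and open half-lines have the same mass, as the law has a density. *)
Lemma beta_law_tail x :
  P [set w | x <= X w] = (1 - beta_law_cdf x)%:E.
Proof.
have int D : measurable D -> mu.-integrable D (EFin \o f).
  by move=> mD; exact: integrableS integrable_f.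
have <- : (\int[mu]_(t in `]x, +oo[) (f t)%:E = P [set w | (x <= X w)%R])%E.
  rewrite tailE integral_itv_obnd_cbnd//.
  by apply/measurable_EFinP; exact: measurable_funTS.
rewrite -[LHS]fineK; last by apply: integrable_fin_num => //; exact: int.
have := @Rintegral_itvB R f -oo%O +oo%O x.
rewrite set_itvNyy => /(_ integrable_f isT isT).
move=> /esym H; congr (_%:E).
by rewrite -/(Rintegral _ _ _) H /beta_law_cdf /Rintegral total.
Qed.

Lemma beta_law_tail_ge1 x : 1 <= x -> 1 - beta_law_cdf x <= 0.
Proof.
move=> x1; rewrite -lee_fin -beta_law_tail tailE.
rewrite (le_trans (mass_le (u := 1) (v := 1) _ _ _))// ?subrr ?mulr0//.
move=> y /=; rewrite in_itv /= andbT => xy /andP[_ y1].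
by have := le_lt_trans (le_trans x1 xy) y1; rewrite ltxx.
Qed.

Lemma beta_law_beta_cdf : beta_cdf a b c beta_law_cdf.
Proof.
split=> [|x x01|x /andP[x0 x1]|x /andP[x0 x1]]; first by rewrite invr_gt0.
- have fcont : {for x, continuous f}.
    have : {for x, continuous (fun t => c * beta_weight a b t)}.
      case/andP: (x01) => x0 x1; have y0 : 0 < 1 - x by rewrite subr_gt0.
      have [df [dw _]] : exists df, is_derive x 1 (fun t => c * beta_weight a b t) df.
        by eexists; rewrite /beta_weight; repeat derive_step.
      exact/differentiable_continuous/derivable1_diffP.
    rewrite /prop_for /continuous_at fE//; apply: cvg_trans.
    apply: near_eq_cvg; case/andP: (x01) => x0 x1; near=> t.
    by rewrite fE//; apply/andP; split; near: t; [exact: lt_nbhsr|exact: lt_nbhsl].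
  have xu : x < x + 1 by rewrite ltrDl.
  have [||dF F'] := @continuous_FTC1 R f -oo%O x _ xu _ _ fcont.
  + by apply: integrableS integrable_f.
  + by rewrite ltNyr.
  by apply: DeriveDef => //; rewrite -derive1E F' fE.
- apply/andP; split; first exact: Rintegral_ge0.
  rewrite -lee_fin fineK; last first.
    by apply: integrable_fin_num => //; exact: integrableS integrable_f.
  rewrite -[x in c * x]subr0; apply: mass_le => //; first exact: ltW.
  by move=> y /=; rewrite in_itv /= => -> /andP[/ltW -> _].
- rewrite -!lee_fin -beta_law_tail measure_ge0 /= tailE.
  apply: mass_le => //; first exact: ltW.
  by move=> y /=; rewrite in_itv /= andbT => -> /andP[_ /ltW ->].
Unshelve. all: by end_near. Qed.
End beta_law.

(** * The tail bound *)

(** Only [e <= 3] is needed, in the form [1 - 1/e <= 2/e]; the sixth power is the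
first for which [(1 - 1/n)^n >= 1/3]. *)
Lemma expRN1_ge (R : realType) : 1 / 3 <= expR (-1) :> R.
Proof.
have -> : (-1 : R) = 6%:R * (- 6^-1) by field.
rewrite expRM_natl; apply: (@le_trans _ _ ((1 + - 6^-1) ^+ 6)); first lra.
by rewrite lerXn2r ?nnegrE ?expR_ge0 ?expR_ge1Dx//; lra.
Qed.

(** The right-hand side is [exp (- (a + b) K(x))], since [a = b p / (1 - p)]. *)
Lemma stein_weight_ratio (R : realType) (a b c p x : R) : 0 < a -> 0 < b -> 0 < c ->
  p = a / (a + b) -> 0 < x < 1 ->
  stein_weight a b c x / stein_weight a b c p =
    expR (- (b * entropy_gain p ((x - p) / (1 - p)))).
Proof.
move=> a0 b0 c0 pE /andP[x0 x1].
have ab0 : 0 < a + b by rewrite addr_gt0.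
have p0 : 0 < p by rewrite pE divr_gt0.
have p1 : p < 1 by rewrite pE ltr_pdivrMr// mul1r ltrDl.
have q0 : 0 < 1 - p by rewrite subr_gt0.
have y0 : 0 < 1 - x by rewrite subr_gt0.
have G0 z : 0 < z -> 0 < 1 - z -> 0 < stein_weight a b c z.
  by move=> z0 z1; rewrite /stein_weight !mulr_gt0 ?powR_gt0.
rewrite -[LHS]lnK ?posrE ?divr_gt0 ?G0//; congr expR.
rewrite ln_div ?posrE ?G0// /stein_weight !lnM ?posrE ?mulr_gt0 ?powR_gt0// !ln_powR.
rewrite /entropy_gain.
have -> : 1 + (1 - p) / p * ((x - p) / (1 - p)) = x / p by field; rewrite !gt_eqF.
have -> : 1 - (x - p) / (1 - p) = (1 - x) / (1 - p) by field; rewrite gt_eqF.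
rewrite !ln_div ?posrE//.
have -> : p / (1 - p) = a / b by rewrite pE; field; rewrite !gt_eqF//; nra.
by field; rewrite gt_eqF.
Qed.

Theorem corollary3p6 (R : realType) (d : measure_display)
    (T : measurableType d) (P : probability T R) (X : {RV P >-> R})
    (a b : R) (ha : 1 <= a) (hb : 1 <= b) (hX : has_beta_law X a b)
    (p : R) (hp : p = a / (a + b)) (eps : R) (heps : 0 <= eps) :
  (P [set w | (eps <= X w - p)%R] <=
    (expR (- ((a + b + 1 + a / b) * eps ^+ 2 /
              (2 * (p * (1 - p) +
                    2 / 3 * Num.max (1 - 2 * p) 0 * eps)))))%R%:E)%E.
Proof.
have -> : [set w | (eps <= X w - p)%R] = [set w | (p + eps <= X w)%R].
  by apply/seteqP; split=> w /=; rewrite lerBrDl.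
rewrite (beta_law_tail hX) lee_fin.
have [x1|x1] := leP 1 (p + eps).
  by rewrite (le_trans (beta_law_tail_ge1 ha hb hX x1))// expR_ge0.
have cdf := beta_law_beta_cdf ha hb hX.
set c := (beta_norm a b)^-1 in cdf; set Phi := beta_law_cdf a b in cdf *.
have a0 : 0 < a by lra.
have b0 : 0 < b by lra.
have ab0 : 0 < a + b by lra.
have p0 : 0 < p by rewrite hp divr_gt0.
have p1 : p < 1 by rewrite hp ltr_pdivrMr// mul1r ltrDl.
have q0 : 0 < 1 - p by rewrite subr_gt0.
have x01 : 0 < p + eps < 1 by rewrite x1 ltr_wpDr.
have p01 : 0 < p < 1 by rewrite p0.
pose t := eps / (1 - p).
have t01 : 0 <= t < 1 by rewrite divr_ge0 ?(ltW q0)//= ltr_pdivrMr// mul1r ltrBrDl.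
set beta := Num.max (1 - 2 * p) 0.
have beta0 : 0 <= beta by rewrite le_max lexx orbT.
have betap : 1 - 2 * p <= beta by rewrite le_max lexx.
have d0 : 0 < p * (1 - p) + 2 / 3 * beta * eps by rewrite ltr_wpDr ?mulr_gt0// !mulr_ge0.
have -> : (a + b + 1 + a / b) * eps ^+ 2 / (2 * (p * (1 - p) + 2 / 3 * beta * eps)) =
    (b + 1) * bernstein_gain p beta t.
  have -> : a + b + 1 + a / b = (b + 1) / (1 - p).
    by rewrite hp; field; rewrite !gt_eqF//; nra.
  by rewrite /bernstein_gain /t; field; rewrite !gt_eqF//; nra.
have ppe : p <= p + eps by rewrite lerDl.
have step1 := tail_over_stein_weight_nincr ha hb cdf p0 ppe x1.
have G0 := stein_weight_gt0 cdf x01; have Gp0 := stein_weight_gt0 cdf p01.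
have := @stein_weight_ratio R a b c p (p + eps) a0 b0 (beta_cdf_scale_gt0 cdf) hp x01.
rewrite [p + eps - p]addrC addKr -/t => GE.
have step2 : 1 - Phi p <= expR (ln 2 - 1).
  have := beta_cdf_mean_ge ha hb cdf; rewrite -hp expRD lnK ?posrE//.
  have := expRN1_ge R; lra.
have := bernstein_le_entropy_scaled p0 p1 beta0 betap hb t01 => gap.
apply: (@le_trans _ _ (expR (ln 2 - 1) * expR (- (b * entropy_gain p t)))); last first.
  by rewrite -expRD ler_expR; lra.
rewrite -GE; apply: (@le_trans _ _ ((1 - Phi p) *
  (stein_weight a b c (p + eps) / stein_weight a b c p))).
  by rewrite mulrA mulrAC -ler_pdivrMr.
by rewrite ler_wpM2r// divr_ge0// ltW.
Qed.
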